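(* If $x^{\star}$ is a local minimizer of the problem $\min\{f(x)/g(x)+h(x): x\in\Omega\cap\mathcal{C}\}$, then $(x^{\star},1/g(x^{\star}))$ is a local min-max point of the problem $\min_{x}\max_{c\in\mathbb{R}}\widetilde{F}(x,c)$. Conversely, if $(x^{\star},c_{\star})$ is a local min-max point of $\min_{x}\max_{c\in\mathbb{R}}\widetilde{F}(x,c)$, then $x^{\star}$ is a local minimizer of $\min\{f(x)/g(x)+h(x): x\in\Omega\cap\mathcal{C}\}$.
   Context: Setting: $f,g:\mathbb{R}^n\to[0,+\infty)$ and $h:\mathbb{R}^n\to\mathbb{R}$ are proper closed (lower semicontinuous), $\mathcal{C}\subseteq\mathbb{R}^n$ is closed, $\Omega:=\{x\in\mathbb{R}^n: g(x)\neq 0\}$, and $\mathcal{C}\cap\Omega\neq\emptyset$. Standing assumptions: (i) $f$ is locally Lipschitz continuous on $\Omega$; (ii) $g$ is convex on $\mathbb{R}^n$; (iii) $h=h_1-h_2$, where $h_1:\mathbb{R}^n\to\mathbb{R}$ is locally Lipschitz differentiable around each $x\in\Omega$ (each $x\in\Omega$ has a ball on which $h_1$ is continuously differentiable with Lipschitz gradient) and $h_2:\mathbb{R}^n\to\mathbb{R}$ is convex. Min-max objective: $\widetilde{F}(x,c):=2cf(x)-c^2f(x)g(x)+h(x)+\iota_{\Omega\cap\mathcal{C}}(x)$ for $(x,c)\in\mathbb{R}^n\times\mathbb{R}$, where $\iota_{\Omega\cap\mathcal{C}}$ equals $0$ on $\Omega\cap\mathcal{C}$ and $+\infty$ elsewhere;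 thus the feasible set for $x$ is $\Omega\cap\mathcal{C}$ and for $c$ is $\mathbb{R}$. Local min-max point: $(x^{\star},c_{\star})\in(\Omega\cap\mathcal{C})\times\mathbb{R}$ is a local min-max point if $c_{\star}$ is a local maximizer of $\widetilde{F}(x^{\star},\cdot)$ over $\mathbb{R}$ and there exists $\epsilon_0>0$ such that, for every $\epsilon\in(0,\epsilon_0]$, $x^{\star}$ is a local minimizer relative to $\Omega\cap\mathcal{C}$ of the function $\varphi_{\epsilon}(x):=\max\{\widetilde{F}(x,c): c\in\mathbb{R},\ |c-c_{\star}|\leq\epsilon\}$. *)

(* Defs.v *)
From HB Require Import structures.
From mathcomp Require Import all_boot all_order all_algebra.
From mathcomp Require Import all_classical all_reals all_analysis.
Import Order.TTheory GRing.Theory Num.Theory.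
Import numFieldNormedType.Exports.

Set Implicit Arguments.
Unset Strict Implicit.
Unset Printing Implicit Defensive.

Local Open Scope classical_set_scope.
Local Open Scope ring_scope.

Section local_extrema.
Context {T : topologicalType} {d : Order.disp_t} {Y : porderType d}.

Definition local_minimizer (A : set T) (phi : T -> Y) (x : T) : Prop :=
  A x /\ \forall y \near within A (nbhs x), (phi x <= phi y)%O.

Definition local_maximizer (A : set T) (phi : T -> Y) (x : T) : Prop :=
  A x /\ \forall y \near within A (nbhs x), (phi y <= phi x)%O.

End local_extrema.

(* The library norm and balls of 'rV[R]_n are those of the max norm. Lipschitz
   continuity on a suitable ball, and hence the two notions below, do not depend
   on the choice of a norm on R^n; only the constants do. *)
Section regularity.
Context {R : realType} {n : nat}.
Implicit Types (f : 'rV[R]_n -> R) (A : set 'rV[R]_n).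

Definition locally_lipschitz_on f A : Prop :=
  forall x, A x -> exists2 r : R, 0 < r &
    [lipschitz (f y : R^o) | y in ball x r `&` A].

Definition gradient f (x : 'rV[R]_n) : 'rV[R]_n :=
  \row_(i < n) 'D_(delta_mx 0 i) (f : _ -> R^o) x.

Definition locally_lipschitz_differentiable_on f A : Prop :=
  forall x, A x -> exists2 r : R, 0 < r &
    [/\ forall y, ball x r y -> differentiable (f : _ -> R^o) y,
        {within ball x r, continuous (gradient f)} &
        [lipschitz gradient f y | y in ball x r]].

End regularity.

Section minmax.
Context {R : realType} {n : nat}.
Implicit Types (f g h : 'rV[R]_n -> R) (C A : set 'rV[R]_n).

Definition Omega g : set 'rV[R]_n := [set x | g x != 0].

(* The indicator in the sense of convex analysis, unlike the library's \1_A. *)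
Definition iota_set A (x : 'rV[R]_n) : \bar R :=
  if x \in A then 0%E else +oo%E.

Definition Ftilde f g h C (x : 'rV[R]_n) (c : R) : \bar R :=
  ((2 * c * f x - c ^+ 2 * f x * g x + h x)%:E
     + iota_set (Omega g `&` C) x)%E.

(* The maximum is expressed as a supremum in \bar R; phi_attained shows that
   it is a genuine maximum. *)
Definition phi f g h C (cs eps : R) (x : 'rV[R]_n) : \bar R :=
  ereal_sup [set Ftilde f g h C x c | c in [set c : R | `|c - cs| <= eps]].

Lemma phi_attained f g h C (cs eps : R) (x : 'rV[R]_n) : 0 <= eps ->
  exists2 c : R, `|c - cs| <= eps & phi f g h C cs eps x = Ftilde f g h C x c.
Proof.
move=> eps0.
pose p (c : R) : R := 2 * c * f x - c ^+ 2 * f x * g x + h x.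
have le_ab : cs - eps <= cs + eps by rewrite lerD2l ge0_cp.
have cp : continuous p.
  move=> c; apply: cvgD; last exact: cvg_cst.
  apply: cvgB.
    by apply: cvgM; [apply: cvgM; [exact: cvg_cst|exact: cvg_id]|exact: cvg_cst].
  apply: cvgM; last exact: cvg_cst.
  by apply: cvgM; [exact: exprn_continuous|exact: cvg_cst].
have [c cin cmax] := EVT_max le_ab (continuous_subspaceT cp).
have itvE t : (t \in `[cs - eps, cs + eps]) = (`|t - cs| <= eps).
  by rewrite in_itv/= ler_distl.
exists c; first by rewrite -itvE.
apply/le_anti/andP; split.
  apply: ge_ereal_sup => _ [t tP <-].
  by rewrite /Ftilde leeD2r// lee_fin; apply: cmax; rewrite itvE.
by apply: ereal_sup_ubound; exists c => //=; rewrite -itvE.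
Qed.

Definition local_minmax_point f g h C (xs : 'rV[R]_n) (cs : R) : Prop :=
  [/\ (Omega g `&` C) xs,
      local_maximizer [set: R] (Ftilde f g h C xs) cs &
      exists2 eps0 : R, 0 < eps0 &
        forall eps : R, 0 < eps <= eps0 ->
          local_minimizer (Omega g `&` C) (phi f g h C cs eps) xs].

End minmax.

(* Main.v *)
(** For [x] feasible and any [c], completing the square gives
      Ftilde x c = f x / g x + h x - (f x / g x) * (c * g x - 1) ^+ 2,
    so the partial maxima [phi] never exceed the ratio objective, with equality
    as soon as [1 / g x] lies in the window for [c].  For a minimizer of the
    ratio objective the window contains [1 / g x] for all nearby [x], because a
    finite convex function on R^n is continuous.  Conversely, at a min-max
    point they agree at the point itself: either [c = 1 / g x], or [f x = 0]
    and the quadratic is constant; no continuity is needed. *)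

Require Import Defs.
From HB Require Import structures.
From mathcomp Require Import all_boot all_order all_algebra.
From mathcomp Require Import all_classical all_reals all_analysis.
From mathcomp Require Import ring lra.
Import Order.TTheory GRing.Theory Num.Theory.
Import numFieldNormedType.Exports.
Local Open Scope classical_set_scope.
Local Open Scope ring_scope.

Set Implicit Arguments.
Unset Strict Implicit.
Unset Printing Implicit Defensive.

Section convex_continuity.
Context (R : realType) (n : nat) (g : 'rV[R]_n -> R).
Hypothesis g_cvx : convex_function [set: 'rV[R]_n] g.

Lemma convex_function_le (t : R) (x y : 'rV[R]_n) : 0 <= t <= 1 ->
  g (t *: x + (1 - t) *: y) <= t * g x + (1 - t) * g y.
Proof.
move=> /andP[t0 t1]; have := g_cvx (Itv01 t0 t1) (in_setT x) (in_setT y).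
by rewrite convRE.
Qed.

Lemma convex_function_midpoint (x y : 'rV[R]_n) :
  g (2^-1 *: (x + y)) <= 2^-1 * (g x + g y).
Proof.
have h01 : 0 <= (2^-1 : R) <= 1 by apply/andP; split; lra.
have := convex_function_le x y h01.
by rewrite (_ : 1 - 2^-1 = 2^-1 :> R) ?scalerDr ?mulrDr//; lra.
Qed.

(** The point [x + t *: e] is a convex combination of [x] and [x + e] or [x - e], according to the
    sign of [t], with weight [|t|] on the latter; the sum of the two absolute values covers both
    signs at once. *)
Lemma convex_function_line_le (x e : 'rV[R]_n) (t : R) : `|t| <= 1 ->
  g (x + t *: e) <=
    g x + `|t| * (`|g (x + e) - g x| + `|g (x - e) - g x|).
Proof.
move=> t1.
have [u [lu eu]] : exists u, g u - g x <= `|g (x + e) - g x| + `|g (x - e) - g x|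
    /\ x + t *: e = `|t| *: u + (1 - `|t|) *: x.
  have p (a b : R) : a <= `|a| + `|b|.
    by rewrite (le_trans (ler_norm _))// lerDl.
  have [t0|t0] := leP 0 t.
    exists (x + e); split; first exact: p.
    by rewrite (ger0_norm t0); apply/rowP => i; rewrite !mxE; ring.
  exists (x - e); split; first by rewrite [leRHS]addrC p.
  by rewrite (ltr0_norm t0); apply/rowP => i; rewrite !mxE; ring.
rewrite eu (le_trans (convex_function_le _ _ _)) ?normr_ge0//.
by have := ler_wpM2l (normr_ge0 t) lu; lra.
Qed.

(** The list [s] is arbitrary so that induction can free one coordinate at a time; the list of all
    indices then gives upper semicontinuity of [g] at [x]. *)
Lemma convex_function_sum_le (x : 'rV[R]_n) (s : seq 'I_n) (eps : R) : 0 < eps ->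
  exists2 d : R, 0 < d & forall v : 'rV[R]_n, (forall i, `|v 0 i| <= d) ->
    g (x + \sum_(i <- s) v 0 i *: delta_mx 0 i) <= g x + eps.
Proof.
elim: s eps => [|i s IH] eps eps0.
  by exists 1 => // v _; rewrite big_nil addr0 lerDl ltW.
have [d d0 dP] := IH _ eps0.
set K := `|g (x + delta_mx 0 i) - g x| + `|g (x - delta_mx 0 i) - g x|.
have K0 : 0 <= K by rewrite addr_ge0.
have K1 : 0 < K + 1 by lra.
have M0 : 0 < Num.min 1 (eps / (K + 1)) by rewrite lt_min ltr01 divr_gt0.
(* The halves leave room for doubling [v]; the cap [1] is what the line estimate requires, and
   [K + 1] avoids dividing by zero. *)
exists (Num.min (d / 2) (Num.min 1 (eps / (K + 1)) / 2)).
  by rewrite lt_min !divr_gt0.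
move=> v vd; rewrite big_cons.
have norm2 (j : 'I_n) : `|2 * v 0 j| <= d /\
    `|2 * v 0 j| <= 1 /\ `|2 * v 0 j| * (K + 1) <= eps.
  rewrite normrM (ger0_norm (ler0n _ _)).
  have := vd j; rewrite le_min !ler_pdivlMr// le_min ler_pdivlMr//.
  by case/and3P=> ? ? ?; split; [|split]; lra.
(* Half of each perturbation, doubled: the midpoint inequality splits off one
   coordinate and leaves the remaining sum to the induction hypothesis. *)
have -> : x + (v 0 i *: delta_mx 0 i + \sum_(j <- s) v 0 j *: delta_mx 0 j) =
    2^-1 *: ((x + (2 * v 0 i) *: delta_mx 0 i) +
             (x + \sum_(j <- s) (2 *: v) 0 j *: delta_mx 0 j)).
  under [in RHS]eq_bigr => j _ do rewrite mxE -scalerA.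
  rewrite -scaler_sumr -scalerA; apply/rowP => k; rewrite !mxE.
  by field.
apply: le_trans (convex_function_midpoint _ _) _.
have [_ [n1 n2]] := norm2 i.
have h1 := convex_function_line_le x (delta_mx 0 i) n1.
have h2 : g (x + \sum_(j <- s) (2 *: v) 0 j *: delta_mx 0 j) <= g x + eps.
  by apply: dP => j; rewrite mxE; have [] := norm2 j.
rewrite -/K in h1.
have := normr_ge0 (2 * v 0 i); lra.
Qed.

(** The upper bound at the reflected point [x - v] becomes a lower bound at [x + v], since
    [2 * g x <= g (x + v) + g (x - v)] by the midpoint inequality. *)
Lemma convex_function_continuous : continuous g.
Proof.
move=> x; apply/(@cvgrPdist_le _ _ _ (nbhs x)) => eps eps0.
have [d d0 dP] := convex_function_sum_le x (index_enum _) eps0.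
have dP' (v : 'rV[R]_n) : `|v| <= d -> g (x + v) <= g x + eps.
  move=> vd; rewrite [v in x + v]row_sum_delta; apply: dP => i.
  apply: le_trans vd.
  rewrite [leRHS]mx_normrE.
  exact: (le_bigmax _ (fun ij : 'I_1 * 'I_n => `|v ij.1 ij.2|) (0, i)).
near=> y.
have xy : `|y - x| <= d.
  rewrite distrC; near: y.
  by move: (@cvg_id _ (nbhs x)) => /cvgrPdist_le; exact.
have h1 := dP' _ xy.
have h2 : g (x - (y - x)) <= g x + eps by apply: dP'; rewrite normrN.
have := convex_function_midpoint (x + (y - x)) (x - (y - x)).
rewrite addrACA subrr addr0 -mulr2n -[x *+ 2]scaler_nat scalerK//.
rewrite subrKC in h1 *.
rewrite ler_distl; lra.
Unshelve. all: by end_near.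
Qed.

End convex_continuity.

Section minmax_objective.
Context (R : realType) (n : nat) (f g h : 'rV[R]_n -> R) (C : set 'rV[R]_n).
Hypothesis f_ge0 : forall x, 0 <= f x.
Hypothesis g_ge0 : forall x, 0 <= g x.

Lemma FtildeE (x : 'rV[R]_n) (c : R) : (Omega g `&` C) x ->
  Ftilde f g h C x c =
    (f x / g x + h x - f x / g x * (c * g x - 1) ^+ 2)%:E.
Proof.
move=> xA; rewrite /Ftilde /iota_set mem_set// adde0; congr _%:E.
by case: xA => /= gx0 _; field.
Qed.

Lemma Ftilde_le (x : 'rV[R]_n) (c : R) : (Omega g `&` C) x ->
  (Ftilde f g h C x c <= (f x / g x + h x)%:E)%E.
Proof.
move=> xA; rewrite FtildeE// lee_fin gerBl.
by rewrite mulr_ge0 ?sqr_ge0 ?divr_ge0.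
Qed.

Lemma Ftilde_inv (x : 'rV[R]_n) : (Omega g `&` C) x ->
  Ftilde f g h C x (1 / g x) = (f x / g x + h x)%:E.
Proof.
move=> xA; rewrite FtildeE// div1r mulVf ?subrr ?expr0n ?mulr0 ?subr0//.
by case: xA.
Qed.

Lemma phi_le (cs eps : R) (x : 'rV[R]_n) : (Omega g `&` C) x ->
  (phi f g h C cs eps x <= (f x / g x + h x)%:E)%E.
Proof. by move=> xA; apply: ge_ereal_sup => _ [c _ <-]; exact: Ftilde_le. Qed.

Lemma phi_eq (cs eps : R) (x : 'rV[R]_n) : (Omega g `&` C) x ->
  `|1 / g x - cs| <= eps -> phi f g h C cs eps x = (f x / g x + h x)%:E.
Proof.
move=> xA xeps; apply/le_anti/andP; split; first exact: phi_le.
by rewrite -Ftilde_inv//; apply: ereal_sup_ubound; exists (1 / g x).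
Qed.

(** For [f x > 0] the objective is a strictly concave quadratic in [c] with vertex [1 / g x], so a
    local maximum is global. *)
Lemma local_maximizer_Ftilde (x : 'rV[R]_n) (c : R) : (Omega g `&` C) x ->
  local_maximizer [set: R] (Ftilde f g h C x) c ->
  Ftilde f g h C x c = (f x / g x + h x)%:E.
Proof.
move=> xA [_]; rewrite withinET => /nbhs_ballP[r /= r0 rP].
have gx0 : g x != 0 by case: xA.
have gx : 0 < g x by rewrite lt_neqAle eq_sym gx0 g_ge0.
have [fx0|fx0] := eqVneq (f x) 0; first by rewrite FtildeE// fx0 !mul0r subr0.
have fg : 0 < f x / g x by rewrite divr_gt0// lt_neqAle eq_sym fx0 f_ge0.
have [->|c1] := eqVneq c (1 / g x); first exact: Ftilde_inv.
have w0 : 0 < `|1 / g x - c| by rewrite normr_gt0 subr_eq0 eq_sym.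
(* Moving c a fraction t of the way towards 1 / g x scales c * g x - 1
   by 1 - t, and so strictly increases the quadratic. *)
pose t := Num.min 1 (r / (2 * `|1 / g x - c|)).
have t0 : 0 < t by rewrite lt_min ltr01 divr_gt0 ?mulr_gt0.
have t1 : t <= 1 by rewrite ge_min lexx.
have tr : t * `|1 / g x - c| < r.
  have : t <= r / (2 * `|1 / g x - c|) by rewrite ge_min lexx orbT.
  rewrite ler_pdivlMr ?mulr_gt0//; lra.
have := rP (c + t * (1 / g x - c)).
rewrite /ball/= opprD addNKr normrN normrM (gtr0_norm t0) => /(_ tr).
rewrite !FtildeE// lee_fin lerD2l lerN2 ler_pM2l//.
have -> : (c + t * (1 / g x - c)) * g x - 1 = (1 - t) * (c * g x - 1).
  by field.
have q0 : 0 < (c * g x - 1) ^+ 2.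
  rewrite exprn_even_gt0//= subr_eq0; apply: contra c1 => /eqP c1.
  by rewrite -c1 mulfK.
(* Local maximality would force [(1 - t) ^+ 2 >= 1], which fails for [0 < t <= 1]. *)
rewrite exprMn leNgt gtr_pMl// => /negP[].
by rewrite expr_lt1//; lra.
Qed.

End minmax_objective.

Theorem proposition3 (R : realType) (n : nat)
  (f g h h1 h2 : 'rV[R]_n -> R) (C : set 'rV[R]_n)
  (f_ge0 : forall x, 0 <= f x)
  (g_ge0 : forall x, 0 <= g x)
  (f_lsc : lower_semicontinuous (fun x => (f x)%:E))
  (g_lsc : lower_semicontinuous (fun x => (g x)%:E))
  (h_lsc : lower_semicontinuous (fun x => (h x)%:E))
  (C_closed : closed C)
  (C_Omega : C `&` Omega g !=set0)
  (f_lip : locally_lipschitz_on f (Omega g))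
  (g_cvx : convex_function [set: 'rV[R]_n] g)
  (h_dec : forall x, h x = h1 x - h2 x)
  (h1_diff : locally_lipschitz_differentiable_on h1 (Omega g))
  (h2_cvx : convex_function [set: 'rV[R]_n] h2) :
  (forall xs : 'rV[R]_n,
     local_minimizer (Omega g `&` C) (fun x => f x / g x + h x) xs ->
     local_minmax_point f g h C xs (1 / g xs)) /\
  (forall (xs : 'rV[R]_n) (cs : R),
     local_minmax_point f g h C xs cs ->
     local_minimizer (Omega g `&` C) (fun x => f x / g x + h x) xs).
Proof.
split=> [xs [xsA xs_min]|xs cs [xsA cs_max [eps0 eps0_gt0 /(_ eps0)]]].
  have gxs0 : g xs != 0 by case: xsA.
  split=> //.
    split=> //; near=> c.
    by rewrite Ftilde_inv//; exact: Ftilde_le.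
  (* The bound [1] is arbitrary: every window is centred at [1 / g xs], and continuity of [1 / g] at
     [xs] handles each radius [eps > 0], on a neighbourhood depending on [eps]. *)
  exists 1 => // eps /andP[eps_gt0 _]; split=> //.
  have ginv : (fun x => 1 / g x) @ xs --> 1 / g xs.
    apply: (@cvgM R _ (nbhs xs) _ (cst 1) (fun x => (g x)^-1)).
      exact: cvg_cst.
    by apply: (@cvgV R _ (nbhs xs)) => //; exact: convex_function_continuous.
  have near_inv : \forall x \near within (Omega g `&` C) (nbhs xs),
      `|1 / g x - 1 / g xs| <= eps.
    move/(@cvgrPdist_le _ _ _ (nbhs xs))/(_ _ eps_gt0): ginv.
    rewrite near_withinE; apply: filterS => x; rewrite distrC => xeps _.
    exact: xeps.
  have near_in : \forall x \near within (Omega g `&` C) (nbhs xs),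
      (Omega g `&` C) x by exact: near_withinT.
  near=> x.
  have xA : (Omega g `&` C) x by near: x.
  rewrite !phi_eq//; last 2 first.
  - by near: x.
  - by rewrite subrr normr0 ltW.
  by rewrite lee_fin; near: x.
rewrite eps0_gt0 lexx => /(_ isT)[_ phi_min]; split=> //.
(* First link of the chain: ratio objective at [xs], then [phi] at [xs], then [phi] at [x], then
   ratio objective at [x]. *)
have phi_xs : ((f xs / g xs + h xs)%:E <= phi f g h C cs eps0 xs)%E.
  rewrite -(local_maximizer_Ftilde _ _ _ cs_max)//.
  by apply: ereal_sup_ubound; exists cs => //=; rewrite subrr normr0 ltW.
have near_in : \forall x \near within (Omega g `&` C) (nbhs xs),
    (Omega g `&` C) x by exact: near_withinT.
near=> x.
rewrite -lee_fin (le_trans phi_xs)// (@le_trans _ _ (phi f g h C cs eps0 x))//.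
  by near: x.
by apply: phi_le => //; near: x.
Unshelve. all: by end_near.
Qed.
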